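(* Let $\mu=\nu$ be Lebesgue measure on $X=Y=[0,1)$. Let $\alpha\in[0,1)$ be irrational and let $(\tau_n)_{n\ge0}$ be maps $[0,1)\to\mathbb{Z}$ with $\tau_0=0$, $\tau_1=1$, such that $\alpha,(\tau_n)$ satisfy properties (i)--(iv) listed in the context. For a strictly increasing sequence $(i_j)_{j\ge2}$ in $\{2,3,\dots\}$ define $c:[0,1)\times[0,1)\to[0,\infty]$ by $$c(x,y)=\begin{cases}h_+(x,y),&(x,y)\text{ in the graph of one of } T^0_\alpha,T^1_\alpha,T^{(\tau_{i_2})}_\alpha,T^{(\tau_{i_3})}_\alpha,\dots,T^{(\tau_{i_j})}_\alpha,\dots\\ +\infty,&\text{otherwise.}\end{cases}$$ If $(i_j)_{j\ge2}$ tends sufficiently fast to infinity (that is: there is a function $G$ from finite sequences of integers, including the empty one, to $\mathbb{N}$ such that the following holds whenever $i_{j+1}\ge G(i_2,\dots,i_j)$ for all $j\ge1$), then for the cost function $c$ the primal value $P$ is strictly positive, while the relaxed primal value $P^{\mathrm{rel}}$, the dual value $D$ and the relaxed dual value $D^{\mathrm{rel}}$ are all equal to $0$. In particular there is a duality gap $P-D^{\mathrm{rel}}>0$.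
   Context: $\oplus$ is addition modulo $1$; $T_\alpha^k(x)=x\oplus k\alpha$ for $k\in\mathbb{Z}$; $T^{(\tau)}_\alpha(x)=T_\alpha^{\tau(x)}(x)$ for $\tau:[0,1)\to\mathbb{Z}$; $a_+=\max(a,0)$. $\delta(x,y)=\min(|x-y|,1-|x-y|)$ is the Riemannian metric on the circle $\mathbb{T}=[0,1)$. For $k\ge0$ put $\varrho_k(x)=1+\#\{0\le i<k:x\oplus i\alpha\in[0,\frac12)\}-\#\{0\le i<k:x\oplus i\alpha\in[\frac12,1)\}$, and for $k<0$ put $\varrho_k(x)=1-\#\{k\le i<0:x\oplus i\alpha\in[0,\frac12)\}+\#\{k\le i<0:x\oplus i\alpha\in[\frac12,1)\}$. Define $h(x,y)=\varrho_k(x)$ if $y=x\oplus k\alpha$ for some $k\in\mathbb{Z}$, and $h(x,y)=+\infty$ otherwise. Properties assumed of $\alpha,(\tau_n)_{n\ge0}$: (i) Each $\tau_n$ is constant on each member of a countable collection of disjoint half open intervals in $[0,1)$ whose union has full measure; for $n\ge0$, $T^{(\tau_n)}_\alpha$ is a measure preserving almost sure bijection of $([0,1),\mu)$ onto itself; and $\int_{[0,1)}h(x,T^{(\tau_n)}_\alpha(x))\,dx=1$ for each $n\ge0$. (ii) For $n\ge1$, $f_n(x)=h(x,T^{(\tau_n)}_\alpha(x))$ satisfies $\|f_n-g_n\|_{L^1(\mu)}<2^{-n}$, where $g_n$ is a Borel function on $[0,1)$ with $\mu\{g_n=0\}=1-\eta_n$ and $\mu\{g_n=\frac{1-\eta_n}{\eta_n}\}=\eta_n$,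 for some sequence $(\eta_n)_{n\ge1}$ tending to $0$. (iii) There is a sequence $(\varphi_n,\psi_n)_{n\ge1}$ of pairs of bounded Borel functions such that, for every fixed $n\ge0$, $\lim_{m\to\infty}\|h(x,T^{(\tau_n)}_\alpha(x))-[\varphi_m(x)+\psi_m(T^{(\tau_n)}_\alpha(x))]\|_{L^1(\mu)}=0$, and $\lim_{n\to\infty}[\int_{[0,1)}\varphi_n(x)\,dx+\int_{[0,1)}\psi_n(y)\,dy]=1$. (iv) $\delta(x,T^{(\tau_n)}_\alpha(x))<2^{-n}$ for $x\in[0,1)$, $n\ge1$. Values of the transport problem: $\Pi(\mu,\nu)$ is the set of Borel probability measures on $X\times Y$ with marginals $\mu,\nu$, and $\Pi(\mu,\nu,c)=\{\pi\in\Pi(\mu,\nu):\int c\,d\pi<\infty\}$ is the set of finite transport plans. - $P=\inf\{\int c\,d\pi:\pi\in\Pi(\mu,\nu)\}$. - $P^{\mathrm{rel}}=\lim_{\varepsilon\to0}\inf\{\int c\,d\pi:\pi\in\Pi^\varepsilon(\mu,\nu)\}$, where $\Pi^\varepsilon(\mu,\nu)$ is the set of nonnegative Borel measures $\pi$ on $X\times Y$ with $\pi(X\times Y)\ge1-\varepsilon$ whose marginals satisfy $p_X(\pi)\le\mu$, $p_Y(\pi)\le\nu$. - $D=\sup\{\int\varphi\,d\mu+\int\psi\,d\nu\}$ over integrable Borel functions $\varphi:X\to[-\infty,\infty)$, $\psi:Y\to[-\infty,\infty)$ with $\varphi(x)+\psi(y)\le c(x,y)$ for all $(x,y)\in X\times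 Y$. - $D^{\mathrm{rel}}=\sup\{\int\varphi\,d\mu+\int\psi\,d\nu\}$ over integrable Borel functions $\varphi,\psi$ such that $\varphi(x)+\psi(y)\le c(x,y)$ holds $\pi$-a.s. for each finite transport plan $\pi\in\Pi(\mu,\nu,c)$. *)

(* Defs.v *)
From HB Require Import structures.
From mathcomp Require Import all_boot all_order all_algebra.
From mathcomp Require Import all_classical all_reals all_analysis.

Set Implicit Arguments.
Unset Strict Implicit.
Unset Printing Implicit Defensive.

Import Order.TTheory GRing.Theory Num.Theory.
Import numFieldNormedType.Exports.
Local Open Scope classical_set_scope.
Local Open Scope ring_scope.

(** * Values of the Monge-Kantorovich transport problem

The two spaces are the subsets [X] of [T1] and [Y] of [T2]. A measure on
[X `*` Y] is represented by a measure on [T1 * T2] that gives no mass to the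
complement of [X `*` Y]; values of functions outside [X] and [Y] are
irrelevant. *)

Definition transport_plan d1 d2 (T1 : measurableType d1)
    (T2 : measurableType d2) (R : realType) (X : set T1) (Y : set T2)
    (mu : {measure set T1 -> \bar R}) (nu : {measure set T2 -> \bar R})
    : set {measure set (T1 * T2)%type -> \bar R} :=
  [set pi | [/\ pi (~` (X `*` Y)) = 0%E,
    pi (X `*` Y) = 1%E,
    (forall A, measurable A -> A `<=` X -> pi (A `*` Y) = mu A) &
    (forall B, measurable B -> B `<=` Y -> pi (X `*` B) = nu B)]].

Definition relaxed_plan d1 d2 (T1 : measurableType d1)
    (T2 : measurableType d2) (R : realType) (X : set T1) (Y : set T2)
    (mu : {measure set T1 -> \bar R}) (nu : {measure set T2 -> \bar R})
    (eps : R) : set {measure set (T1 * T2)%type -> \bar R} :=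
  [set pi | [/\ pi (~` (X `*` Y)) = 0%E,
    ((1 - eps)%:E <= pi (X `*` Y))%E,
    (forall A, measurable A -> A `<=` X -> (pi (A `*` Y) <= mu A)%E) &
    (forall B, measurable B -> B `<=` Y -> (pi (X `*` B) <= nu B)%E)]].

Definition plan_cost d1 d2 (T1 : measurableType d1)
    (T2 : measurableType d2) (R : realType) (X : set T1) (Y : set T2)
    (c : T1 -> T2 -> \bar R)
    (pi : {measure set (T1 * T2)%type -> \bar R}) : \bar R :=
  (\int[pi]_(p in X `*` Y) c p.1 p.2)%E.

Definition finite_plan d1 d2 (T1 : measurableType d1)
    (T2 : measurableType d2) (R : realType) (X : set T1) (Y : set T2)
    (mu : {measure set T1 -> \bar R}) (nu : {measure set T2 -> \bar R})
    (c : T1 -> T2 -> \bar R) : set {measure set (T1 * T2)%type -> \bar R} :=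
  [set pi | transport_plan X Y mu nu pi /\ (plan_cost X Y c pi < +oo)%E].

Definition primal_value d1 d2 (T1 : measurableType d1)
    (T2 : measurableType d2) (R : realType) (X : set T1) (Y : set T2)
    (mu : {measure set T1 -> \bar R}) (nu : {measure set T2 -> \bar R})
    (c : T1 -> T2 -> \bar R) : \bar R :=
  ereal_inf [set plan_cost X Y c pi | pi in transport_plan X Y mu nu].

(* The infimum is nonincreasing in [eps], so the limit always exists. *)
Definition relaxed_primal_value d1 d2 (T1 : measurableType d1)
    (T2 : measurableType d2) (R : realType) (X : set T1) (Y : set T2)
    (mu : {measure set T1 -> \bar R}) (nu : {measure set T2 -> \bar R})
    (c : T1 -> T2 -> \bar R) : \bar R :=
  lim (ereal_inf [set plan_cost X Y c pi | pi in relaxed_plan X Y mu nu eps]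
       @[eps --> (0 : R)^'+]).

Definition potential d (T : measurableType d) (R : realType) (X : set T)
    (mu : {measure set T -> \bar R}) : set (T -> \bar R) :=
  [set phi | mu.-integrable X phi /\ forall x, X x -> (phi x < +oo)%E].

Definition dual_payoff d1 d2 (T1 : measurableType d1)
    (T2 : measurableType d2) (R : realType) (X : set T1) (Y : set T2)
    (mu : {measure set T1 -> \bar R}) (nu : {measure set T2 -> \bar R})
    (u : (T1 -> \bar R) * (T2 -> \bar R)) : \bar R :=
  (\int[mu]_(x in X) u.1 x + \int[nu]_(y in Y) u.2 y)%E.

Definition dual_value d1 d2 (T1 : measurableType d1)
    (T2 : measurableType d2) (R : realType) (X : set T1) (Y : set T2)
    (mu : {measure set T1 -> \bar R}) (nu : {measure set T2 -> \bar R})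
    (c : T1 -> T2 -> \bar R) : \bar R :=
  ereal_sup [set dual_payoff X Y mu nu u | u in
    [set u | [/\ potential X mu u.1, potential Y nu u.2 &
      forall x y, X x -> Y y -> (u.1 x + u.2 y <= c x y)%E]]].

Definition relaxed_dual_value d1 d2 (T1 : measurableType d1)
    (T2 : measurableType d2) (R : realType) (X : set T1) (Y : set T2)
    (mu : {measure set T1 -> \bar R}) (nu : {measure set T2 -> \bar R})
    (c : T1 -> T2 -> \bar R) : \bar R :=
  ereal_sup [set dual_payoff X Y mu nu u | u in
    [set u | [/\ potential X mu u.1, potential Y nu u.2 &
      forall pi, finite_plan X Y mu nu c pi ->
        {ae pi, forall p, X p.1 -> Y p.2 ->
                  (u.1 p.1 + u.2 p.2 <= c p.1 p.2)%E}]]].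

(** * Rotations of the circle [0, 1) *)

Definition unit_circle (R : realType) : set R := `[0, 1[%classic.
Arguments unit_circle : clear implicits.

Definition circle_add (R : realType) (x y : R) : R :=
  x + y - (Num.floor (x + y))%:~R.

Definition circle_dist (R : realType) (x y : R) : R :=
  Num.min `|x - y| (1 - `|x - y|).

Definition circle_rot (R : realType) (alpha : R) (k : int) (x : R) : R :=
  circle_add x (k%:~R * alpha).

Definition circle_rot_by (R : realType) (alpha : R) (tau : R -> int) (x : R) : R :=
  circle_rot alpha (tau x) x.

(* For [k = Negz n = - n.+1] the index [i] of the definition, [k <= i < 0],
   is [- j] with [1 <= j <= n.+1]. *)
Definition rho (R : realType) (alpha : R) (k : int) (x : R) : int :=
  match k with
  | Posz n =>
      1 + (count (fun i : nat => circle_rot alpha i x \in `[0, 2^-1[) (iota 0 n))%:Z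
        - (count (fun i : nat => circle_rot alpha i x \in `[2^-1, 1[) (iota 0 n))%:Z
  | Negz n =>
      1 - (count (fun j : nat => circle_rot alpha (- j%:Z) x \in `[0, 2^-1[)
                 (iota 1 n.+1))%:Z
        + (count (fun j : nat => circle_rot alpha (- j%:Z) x \in `[2^-1, 1[)
                 (iota 1 n.+1))%:Z
  end.

(* For irrational [alpha] there is at most one [k] with [y = circle_rot alpha k x];
   [xget] selects it. *)
Definition hfun (R : realType) (alpha : R) (x y : R) : \bar R :=
  if `[< exists k : int, y = circle_rot alpha k x >]
  then ((rho alpha (xget 0 [set k : int | y = circle_rot alpha k x]) x)%:~R)%:E
  else +oo%E.

Definition circle_graph (R : realType) (f : R -> R) : set (R * R)%type :=
  [set p | unit_circle R p.1 /\ p.2 = f p.1].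

(* Only the values [i j] with [2 <= j] are used. *)
Definition cost (R : realType) (alpha : R) (tau : nat -> R -> int)
    (i : nat -> nat) (x y : R) : \bar R :=
  if `[< circle_graph (circle_rot alpha 0) (x, y) \/
         circle_graph (circle_rot alpha 1) (x, y) \/
         exists2 j, (2 <= j)%N &
           circle_graph (circle_rot_by alpha (tau (i j))) (x, y) >]
  then maxe (hfun alpha x y) 0%E
  else +oo%E.

(** * Assumptions on [alpha] and [(tau_n)] *)

(* A finite collection of intervals is obtained by taking empty ones. *)
Definition piecewise_constant (R : realType) (tau : R -> int) : Prop :=
  exists a b : nat -> R,
    [/\ forall k, `[a k, b k[%classic `<=` unit_circle R,
        trivIset setT (fun k => `[a k, b k[%classic),
        lebesgue_measure (\bigcup_k `[a k, b k[%classic) = 1%E &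
        forall k x y, x \in `[a k, b k[ -> y \in `[a k, b k[ -> tau x = tau y].

Definition measure_preserving (R : realType) (T : R -> R) : Prop :=
  measurable_fun (unit_circle R) T /\
  forall E : set R, measurable E -> E `<=` unit_circle R ->
    lebesgue_measure (unit_circle R `&` T @^-1` E) = lebesgue_measure E.

Definition almost_sure_bijection (R : realType) (T : R -> R) : Prop :=
  exists A B : set R,
    [/\ measurable A /\ A `<=` unit_circle R,
        measurable B /\ B `<=` unit_circle R,
        lebesgue_measure A = 1%E, lebesgue_measure B = 1%E &
        set_bij A B T].

Definition L1_norm (R : realType) (f : R -> \bar R) : \bar R :=
  (\int[lebesgue_measure]_(x in unit_circle R) `|f x|)%E.

Definition property_i (R : realType) (alpha : R) (tau : nat -> R -> int)
    : Prop :=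
  forall n : nat,
    [/\ piecewise_constant (tau n),
        measure_preserving (circle_rot_by alpha (tau n)),
        almost_sure_bijection (circle_rot_by alpha (tau n)) &
        (\int[lebesgue_measure]_(x in unit_circle R)
          hfun alpha x (circle_rot_by alpha (tau n) x) = 1)%E].

Definition property_ii (R : realType) (alpha : R) (tau : nat -> R -> int)
    : Prop :=
  exists (eta : nat -> R) (g : nat -> R -> R),
    eta n @[n --> \oo] --> (0 : R) /\
    forall n, (1 <= n)%N ->
      [/\ 0 < eta n,
          measurable_fun (unit_circle R) (g n),
          lebesgue_measure (unit_circle R `&` [set x | g n x = 0])
            = (1 - eta n)%:E,
          lebesgue_measure
            (unit_circle R `&` [set x | g n x = (1 - eta n) / eta n])
            = (eta n)%:E &
          (L1_norm (fun x => hfun alpha x (circle_rot_by alpha (tau n) x) - (g n x)%:E)%E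
             < (2 ^- n)%:E)%E].

Definition property_iii (R : realType) (alpha : R) (tau : nat -> R -> int)
    : Prop :=
  exists phi psi : nat -> R -> R,
    [/\ forall m, (1 <= m)%N ->
          measurable_fun (unit_circle R) (phi m) /\
          [bounded phi m x | x in unit_circle R],
        forall m, (1 <= m)%N ->
          measurable_fun (unit_circle R) (psi m) /\
          [bounded psi m x | x in unit_circle R],
        forall n : nat,
          L1_norm (fun x => hfun alpha x (circle_rot_by alpha (tau n) x) -
              (phi m x + psi m (circle_rot_by alpha (tau n) x))%:E)%E
            @[m --> \oo] --> 0%E &
        (\int[lebesgue_measure]_(x in unit_circle R) (phi n x)%:E +
         \int[lebesgue_measure]_(y in unit_circle R) (psi n y)%:E)%E
          @[n --> \oo] --> 1%E].

Definition property_iv (R : realType) (alpha : R) (tau : nat -> R -> int)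
    : Prop :=
  forall n x, (1 <= n)%N -> unit_circle R x ->
    circle_dist x (circle_rot_by alpha (tau n) x) < 2 ^- n.

(* Main.v *)
Require Import Defs.
From HB Require Import structures.
From mathcomp Require Import all_boot all_order all_algebra.
From mathcomp Require Import all_classical all_reals all_analysis.
From mathcomp Require Import measurable_realfun.
From mathcomp Require Import ring lra.

Set Implicit Arguments.
Unset Strict Implicit.
Unset Printing Implicit Defensive.

Import Order.TTheory GRing.Theory Num.Theory.
Import numFieldNormedType.Exports.
Local Open Scope classical_set_scope.
Local Open Scope ring_scope.

(** Why there is a gap. Write [T_n] for the map [circle_rot_by alpha (tau n)] and
[f_n x] for [h (x, T_n x)], which has integral [1].

Almost all of the mass can be moved for free: by (ii) [f_n] is within [2^-n] in
[L^1] of a function vanishing off a set of mass [eta_n], so moving only the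
points where that function vanishes along [T_n] costs less than [2^-n]. This
makes the relaxed primal value zero ([relaxed_primal_value_eq0]). It also bounds
relaxed dual payoffs: potentials satisfy [phi + psi <= c] almost everywhere on
the graph of [T_n], and the exceptional set of mass [eta_n] adds at most
[2 K eta_n] plus the parts of [phi] and [psi] above the level [K]
([relaxed_dual_value_le0]).

Moving all of the mass costs at least [1]. The bounded functions [phi_m],
[psi_m] of (iii) have integrals adding up to nearly [1], and
[phi_m x + psi_m y] is nearly [h (x, y)] on any fixed finite set of graphs, so
that a plan carried by finitely many graphs has cost at least [1]. For
infinitely many graphs, (iv) says that [T_n] tends to the identity, hence
[phi_m x + psi_m (T_n x)] is close, for [n] large, to [phi_m x + psi_m x],
which is close to [h (x, x) = 1] by the case [n = 0] of (iii). Integrating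
[phi_m + psi_m] against a plan therefore shows that, up to small errors, [1] is
at most the cost on the first [J] graphs plus the mass given to the later ones,
and this mass tends to [0] with [J] ([plan_cost_ge1]). For this the errors of
the graphs after [J] must have a small sum although [m] depends on [J]; since
[m] only depends on the first [J] graphs, it suffices to choose every new index
large enough for the finitely many [m] in use so far ([fast_sequence_choice]),
given that [psi_m \o T_n] tends to [psi_m] in [L^1]
([cvg_L1_circle_composition]). *)

(** * Transport plans and weak duality *)

(** Moving negative parts to the other side turns an inequality between signed
extended reals into one between nonnegative ones, which survives integration
without any integrability of [c]. *)
Lemma lee_maxeD (R : realType) (a b c : \bar R) :
  (a < +oo -> b < +oo -> 0 <= c -> a + b <= c ->
   maxe a 0 + maxe b 0 <= c + (maxe (- a) 0 + maxe (- b) 0))%E.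
Proof.
have [m0 m1] : (maxe -oo 0 = 0 :> \bar R)%E /\ (maxe +oo 0 = +oo :> \bar R)%E.
  by rewrite maxNye maxye.
move: a b c => [a| |] [b| |] [c| |] //= _ _.
- rewrite !lee_fin -!EFin_max -!EFinD lee_fin.
  by case: (leP a 0); case: (leP b 0); case: (leP (- a) 0); case: (leP (- b) 0); lra.
all: by rewrite ?m0 ?m1 -?EFin_max //= -?EFinD ?addye ?addey //= ?leey.
Qed.

Section transport.
Context d1 d2 (T1 : measurableType d1) (T2 : measurableType d2) (R : realType).
Variables (X : set T1) (Y : set T2) (mX : measurable X) (mY : measurable Y).
Variables (mu : {measure set T1 -> \bar R}) (nu : {measure set T2 -> \bar R}).
Implicit Type pi : {measure set (T1 * T2)%type -> \bar R}.
Local Open Scope ereal_scope.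

Let mXY : measurable (X `*` Y). Proof. exact: measurableX. Qed.

Let measurable_prod_fst (f : T1 -> \bar R) : measurable_fun X f ->
  measurable_fun (X `*` [set: T2]) (fun p => f p.1).
Proof.
move=> mf; apply: (@measurable_comp _ _ _ _ _ _ X f _ fst) => //.
  by move=> _ [p [Xp _] <-].
exact: measurable_funTS.
Qed.

Let measurable_prod_snd (f : T2 -> \bar R) : measurable_fun Y f ->
  measurable_fun ([set: T1] `*` Y) (fun p => f p.2).
Proof.
move=> mf; apply: (@measurable_comp _ _ _ _ _ _ Y f _ snd) => //.
  by move=> _ [p [_ Yp] <-].
exact: measurable_funTS.
Qed.

Lemma measurable_funX_fst (f : T1 -> \bar R) : measurable_fun X f ->
  measurable_fun (X `*` Y) (fun p => f p.1).
Proof.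
by move=> /measurable_prod_fst; apply: measurable_funS => [|p [//]]; exact: measurableX.
Qed.

Lemma measurable_funX_snd (f : T2 -> \bar R) : measurable_fun Y f ->
  measurable_fun (X `*` Y) (fun p => f p.2).
Proof.
by move=> /measurable_prod_snd; apply: measurable_funS => [|p [//]]; exact: measurableX.
Qed.

Let plan_setI pi (B : set (T1 * T2)) : transport_plan X Y mu nu pi ->
  measurable B -> pi B = pi (B `&` X `*` Y).
Proof.
move=> [piC _ _ _] mB.
have -> : pi B = pi (B `\` X `*` Y) + pi (B `&` X `*` Y) by exact: measureDI.
suff -> : pi (B `\` X `*` Y) = 0 by rewrite add0e.
apply: (subset_measure0 _ _ _ piC) => [||p [//]]; first exact: measurableD.
exact: measurableC.
Qed.

(** The marginals are prescribed on subsets of [X] only, so the integral over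
[X `*` Y] is compared with the one over [X `*` setT] first. *)
Lemma ge0_integral_plan_fst pi (f : T1 -> \bar R) :
  transport_plan X Y mu nu pi -> measurable_fun X f ->
  (forall x, X x -> 0 <= f x) ->
  \int[pi]_(p in X `*` Y) f p.1 = \int[mu]_(x in X) f x.
Proof.
move=> plan mf f0; have [piC _ pimu _] := plan.
transitivity (\int[pushforward pi fst]_(x in X) f x).
  rewrite [RHS]ge0_integral_pushforward//; last by move=> x /set_mem /f0.
  have -> : fst @^-1` X = X `*` [set: T2] by apply/seteqP; split=> p //= [].
  rewrite [RHS](ge0_negligible_integral _ _ _ _ piC)//.
  - congr integral; apply/seteqP; split=> p /=.
      by move=> [Xp Yp]; split => // ; case; exact.
    by move=> [[Xp _]] /contrapT.
  - exact: measurableC.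
  - exact: measurableX.
  - exact: measurable_prod_fst.
  - by move=> p [Xp _]; exact: f0.
apply: eq_measure_integral => A mA AX; rewrite -pimu// /pushforward.
rewrite [LHS](plan_setI plan); first congr (pi _).
  apply/seteqP; split=> p /=; [case=> ? [] //| case => /[dup] /AX //].
by rewrite -[X in measurable X]setTI; exact: measurable_fst.
Qed.

Lemma ge0_integral_plan_snd pi (f : T2 -> \bar R) :
  transport_plan X Y mu nu pi -> measurable_fun Y f ->
  (forall y, Y y -> 0 <= f y) ->
  \int[pi]_(p in X `*` Y) f p.2 = \int[nu]_(y in Y) f y.
Proof.
move=> plan mf f0; have [piC _ _ pinu] := plan.
transitivity (\int[pushforward pi snd]_(y in Y) f y).
  rewrite [RHS]ge0_integral_pushforward//; last by move=> x /set_mem /f0.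
  have -> : snd @^-1` Y = [set: T1] `*` Y by apply/seteqP; split=> p //= [].
  rewrite [RHS](ge0_negligible_integral _ _ _ _ piC)//.
  - congr integral; apply/seteqP; split=> p /=.
      by move=> [Xp Yp]; split => // ; case; exact.
    by move=> [[Xp _]] /contrapT.
  - exact: measurableC.
  - exact: measurableX.
  - exact: measurable_prod_snd.
  - by move=> p [_ Yp]; exact: f0.
apply: eq_measure_integral => A mA AY; rewrite -pinu// /pushforward.
rewrite [LHS](plan_setI plan); first congr (pi _).
  apply/seteqP; split=> p /=; [case=> ? [] //| case => ? /[dup] /AY //].
by rewrite -[X in measurable X]setTI; exact: measurable_snd.
Qed.

(** The measurable upper bound [F] stands in for the cost, so that the same lemma
bounds costs from below (take for [F] the cost plus error terms) and dual
payoffs from above (take for [pi] a plan of known cost). *)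
Lemma weak_duality pi (phi : T1 -> \bar R) (psi : T2 -> \bar R)
    (F : T1 * T2 -> \bar R) :
  transport_plan X Y mu nu pi ->
  potential X mu phi -> potential Y nu psi ->
  measurable_fun (X `*` Y) F -> (forall p, (X `*` Y) p -> 0 <= F p) ->
  {ae pi, forall p, (X `*` Y) p -> phi p.1 + psi p.2 <= F p} ->
  dual_payoff X Y mu nu (phi, psi) <= \int[pi]_(p in X `*` Y) F p.
Proof.
move=> plan [iphi phiy] [ipsi psiy] mF F0 leF.
have mphi := measurable_int _ iphi; have mpsi := measurable_int _ ipsi.
have [mpp mpn] := (measurable_funepos mphi, measurable_funeneg mphi).
have [msp msn] := (measurable_funepos mpsi, measurable_funeneg mpsi).
have : \int[pi]_(p in X `*` Y) (phi^\+ p.1 + psi^\+ p.2) <=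
       \int[pi]_(p in X `*` Y) (F p + (phi^\- p.1 + psi^\- p.2)).
  apply: ae_ge0_le_integral => //.
  - by move=> p _; exact: adde_ge0.
  - by apply: emeasurable_funD; [exact: measurable_funX_fst|exact: measurable_funX_snd].
  - by move=> p XYp; rewrite !adde_ge0// F0.
  - apply: emeasurable_funD => //.
    by apply: emeasurable_funD; [exact: measurable_funX_fst|exact: measurable_funX_snd].
  apply: filterS leF => p leF XYp.
  have [Xp Yp] := XYp; rewrite !funeposE !funenegE.
  exact: (lee_maxeD (phiy _ Xp) (psiy _ Yp) (F0 _ XYp) (leF XYp)).
have X1 f := @measurable_funX_fst f; have X2 f := @measurable_funX_snd f.
rewrite [leLHS]ge0_integralD//; [|exact: X1|exact: X2].
rewrite [leRHS]ge0_integralD//; last 2 first.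
- by move=> p _; exact: adde_ge0.
- by apply: emeasurable_funD; [exact: X1|exact: X2].
rewrite [X in _ <= _ + X]ge0_integralD//; [|exact: X1|exact: X2].
rewrite !(ge0_integral_plan_fst plan)// !(ge0_integral_plan_snd plan)//.
rewrite /dual_payoff/= [X in _ -> X + _ <= _]integralE [X in _ -> _ + X <= _]integralE.
have := integrable_pos_fin_num mX iphi; have := integrable_neg_fin_num mX iphi.
have := integrable_pos_fin_num mY ipsi; have := integrable_neg_fin_num mY ipsi.
move: (\int[mu]_(x in X) phi^\+ x) (\int[mu]_(x in X) phi^\- x).
move: (\int[nu]_(x in Y) psi^\+ x) (\int[nu]_(x in Y) psi^\- x).
have : 0 <= \int[pi]_(x in X `*` Y) F x by apply: integral_ge0.
move: (\int[pi]_(x in X `*` Y) F x) => [r| |] // _ [a| |]// [b| |]// [c| |]// [d| |]// _ _ _ _.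
  by rewrite !lee_fin; lra.
by move=> _; rewrite leey.
Qed.

Lemma dual_value_le_relaxed (c : T1 -> T2 -> \bar R) :
  dual_value X Y mu nu c <= relaxed_dual_value X Y mu nu c.
Proof.
apply: ereal_sup_le => _ [u [pphi ppsi le] <-]; exists u => //.
split => // pi _; apply: aeW => p; exact: le.
Qed.

Lemma dual_value_ge0 (c : T1 -> T2 -> \bar R) :
  (forall x y, X x -> Y y -> 0 <= c x y) -> 0 <= dual_value X Y mu nu c.
Proof.
move=> c0; apply: ereal_sup_ubound; exists (cst 0, cst 0).
  split=> [||x y Xx Yy] /=; last by rewrite add0e; exact: c0.
    by split; [exact: integrable0|move=> x _; exact: ltry].
  by split; [exact: integrable0|move=> x _; exact: ltry].
by rewrite /dual_payoff/= !integral0 adde0.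
Qed.

End transport.

(** * Plans carried by a graph *)

Section graph_measure.
Context d1 d2 (T1 : measurableType d1) (T2 : measurableType d2) (R : realType).
Variables (X : set T1) (Y : set T2) (mX : measurable X) (mY : measurable Y).
Variables (mu : {measure set T1 -> \bar R}) (T : T1 -> T2).
Hypotheses (mT : measurable_fun X T) (XY : set_fun X Y T).
Local Open Scope ereal_scope.

(** [T] is measurable on [X] only, whence the extension [T \_ X] by a default
value in the proofs about graphs. *)
Lemma measurable_fun_graph d3 (T3 : measurableType d3) (k : T1 * T2 -> T3) :
  measurable_fun (X `*` Y) k -> measurable_fun X (fun x => k (x, T x)).
Proof.
move=> mk; pose G x := (x, (T \_ X) x).
have mG : measurable_fun setT G.
  by apply: measurable_fun_pair => //; apply/(measurable_restrictT _ mX).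
apply: (@eq_measurable_fun _ _ _ _ X (k \o G)).
  by move=> x xX; rewrite /G /= patchE xX.
apply: (@measurable_comp _ _ _ _ _ _ (X `*` Y) k _ G) => //.
- exact: measurableX.
- by move=> _ [x Xx <-]; rewrite /G patchE mem_set//; split => //=; exact: XY.
- exact: measurable_funTS.
Qed.

(** The image of [mu] restricted to [A] under [x |-> (x, T x)]. *)
Lemma graph_measure A : measurable A -> A `<=` X ->
  exists pi : {measure set (T1 * T2)%type -> \bar R},
    (forall B, measurable B -> pi B = mu (A `&` [set x | B (x, T x)])) /\
    forall k : T1 * T2 -> \bar R, measurable_fun (X `*` Y) k ->
      (forall p, (X `*` Y) p -> 0 <= k p) ->
      \int[pi]_(p in X `*` Y) k p = \int[mu]_(x in A) k (x, T x).
Proof.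
move=> mA AX; pose G x := (x, (T \_ X) x).
have mG : measurable_fun setT G.
  by apply: measurable_fun_pair => //; apply/(measurable_restrictT _ mX).
have GE x : A x -> G x = (x, T x) by move=> /AX Xx; rewrite /G patchE mem_set.
have mXY : measurable (X `*` Y) by exact: measurableX.
unshelve (exists (pushforward (mrestr mu mA) G)); first exact: mG.
split => [B mB|k mk k0].
  rewrite /pushforward /mrestr/=; congr (mu _); apply/seteqP.
  by split=> x /= [+ +]; [move=> + Ax|move=> Ax]; rewrite GE.
rewrite ge0_integral_pushforward//; last by move=> p /set_mem /k0.
have mD : measurable (G @^-1` (X `*` Y)) by rewrite -[X in measurable X]setTI; exact: mG.
have AD : A `<=` G @^-1` (X `*` Y).
  by move=> x Ax; change ((X `*` Y) (G x)); rewrite GE//; split => /=; [exact: AX|exact/XY/AX].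
rewrite (@ge0_negligible_integral _ _ _ _ _ (~` A))//; last 4 first.
- exact: measurableC.
- apply: (@measurable_comp _ _ _ _ _ _ (X `*` Y) k _ G) => //.
    by move=> _ [x Dx <-].
  exact: measurable_funTS.
- by move=> x; exact: k0.
- by rewrite /= /mrestr setICl measure0.
rewrite setDE setCK setIidr//.
rewrite (@eq_measure_integral _ _ _ _ mu)//; last first.
  by move=> B mB BA; rewrite /= /mrestr setIidl.
by apply: eq_integral => x /set_mem Ax /=; rewrite GE.
Qed.

End graph_measure.

Section graph_plan.
Context d (T0 : measurableType d) (R : realType).
Variables (X : set T0) (mX : measurable X).
Variables (mu : {measure set T0 -> \bar R}) (T : T0 -> T0).
Hypotheses (mu1 : mu X = 1%E) (mT : measurable_fun X T) (XX : set_fun X X T).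
Hypothesis muT : forall E, measurable E -> E `<=` X -> mu (X `&` T @^-1` E) = mu E.
Local Open Scope ereal_scope.

Lemma graph_plan : exists2 pi, transport_plan X X mu mu pi &
    (forall B, measurable B -> pi B = mu (X `&` [set x | B (x, T x)])) /\
    forall k : T0 * T0 -> \bar R, measurable_fun (X `*` X) k ->
      (forall p, (X `*` X) p -> 0 <= k p) ->
      \int[pi]_(p in X `*` X) k p = \int[mu]_(x in X) k (x, T x).
Proof.
have [pi [piE pi_int]] := graph_measure mX mX mu mT XX mX (@subset_refl _ X).
have mXX : measurable (X `*` X) by exact: measurableX.
exists pi => //; split.
- rewrite piE; last exact: measurableC.
  rewrite [X in mu X](_ : _ = set0) ?measure0//; apply/seteqP; split=> x //= [Xx].
  by case; split => //; exact: XX.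
- rewrite piE// -mu1; congr (mu _).
  by apply/seteqP; split=> x //= => [[]//|Xx]; split => //; split => //=; exact: XX.
- move=> A mA AX; rewrite piE; last exact: measurableX.
  congr (mu _); apply/seteqP; split=> x //= => [[_ []]//|Ax].
  by split; [exact: AX|split => //; exact/XX/AX].
- move=> A mA AX; rewrite piE; last exact: measurableX.
  rewrite -(muT mA AX); congr (mu _); apply/seteqP.
  by split=> x /= => [[Xx []]//|[]].
Qed.

Lemma relaxed_graph_plan A (eps : R) : measurable A -> A `<=` X ->
  (1 - eps)%:E <= mu A ->
  exists2 pi, relaxed_plan X X mu mu eps pi &
    forall k : T0 * T0 -> \bar R, measurable_fun (X `*` X) k ->
      (forall p, (X `*` X) p -> 0 <= k p) ->
      \int[pi]_(p in X `*` X) k p = \int[mu]_(x in A) k (x, T x).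
Proof.
move=> mA AX leA.
have [pi [piE pi_int]] := graph_measure mX mX mu mT XX mA AX.
have mXX : measurable (X `*` X) by exact: measurableX.
exists pi => //; split.
- rewrite piE; last exact: measurableC.
  rewrite [X in mu X](_ : _ = set0) ?measure0//; apply/seteqP; split=> x //= [Ax].
  by case; split => /=; [exact: AX|exact/XX/AX].
- rewrite piE// (le_trans leA)// [leRHS](_ : _ = mu A)//; congr (mu _).
  apply/seteqP; split=> x //= => [[]//|Ax]; split => //.
  by split => /=; [exact: AX|exact/XX/AX].
- move=> B mB BX; have mBX : measurable (B `*` X) by exact: measurableX.
  rewrite piE// [X in mu X](_ : _ = A `&` B).
    by apply: le_measure; rewrite ?inE//; exact: measurableI.
  apply/seteqP; split=> x /= [Ax]; first by case.
  by move=> Bx; split => //; split => //=; exact/XX/AX.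
- move=> B mB BX; have mXB : measurable (X `*` B) by exact: measurableX.
  rewrite piE// -(muT mB BX) [X in mu X](_ : _ = A `&` (X `&` T @^-1` B)).
    apply: le_measure; rewrite ?inE//; last exact: mT.
    by apply: measurableI => //; exact: mT.
  by apply/seteqP; split=> x /= [Ax].
Qed.
End graph_plan.

(** * Lower bounds for costs carried by countably many graphs *)

Section graph_decomposition.
Context d1 d2 (T1 : measurableType d1) (T2 : measurableType d2) (R : realType).
Variables (X : set T1) (Y : set T2) (mX : measurable X) (mY : measurable Y).
Variables (mu : {measure set T1 -> \bar R}) (nu : {measure set T2 -> \bar R}).
Variables (c : T1 -> T2 -> \bar R) (Gamma : nat -> set (T1 * T2)).
Implicit Type pi : {measure set (T1 * T2)%type -> \bar R}.
Local Open Scope ereal_scope.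

Definition tail_graphs J := \bigcup_k Gamma k `\` \bigcup_(k < J) Gamma k.

(** A certificate that the cost is nearly at least [1]: up to errors depending
on [x] alone, [phi + psi] is below [c] on the first [J] graphs and below [1] on
the later ones. The integrals of the errors [e k] decrease geometrically, since
a plan may charge all the graphs at once. *)
Definition almost_dual (J : nat) (eps : R) : Prop :=
  exists (phi : T1 -> \bar R) (psi : T2 -> \bar R) (a : T1 -> \bar R)
      (e : nat -> T1 -> \bar R),
    [/\ potential X mu phi /\ potential Y nu psi,
        [/\ measurable_fun X a, forall x, X x -> 0 <= a x,
          forall k, measurable_fun X (e k) & forall k x, X x -> 0 <= e k x],
        [/\ (1 - eps)%:E <= dual_payoff X Y mu nu (phi, psi),
          \int[mu]_(x in X) a x <= eps%:E &
          forall k, \int[mu]_(x in X) e k x <= (eps / (2 ^ k.+1)%:R)%:E],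
        (forall k x y, (k < J)%N -> X x -> Y y -> Gamma k (x, y) ->
           phi x + psi y <= c x y + e k x) &
        (forall k x y, (J <= k)%N -> X x -> Y y -> Gamma k (x, y) ->
           phi x + psi y <= 1 + a x + e k x)].

Hypothesis mGamma : forall k, measurable (Gamma k).
Hypothesis mc : measurable_fun (X `*` Y) (fun p => c p.1 p.2).
Hypothesis c_ge0 : forall x y, X x -> Y y -> 0 <= c x y.
Hypothesis c_off : forall x y, X x -> Y y ->
  ~ (\bigcup_k Gamma k) (x, y) -> c x y = +oo.

Let mXY : measurable (X `*` Y). Proof. exact: measurableX. Qed.

Let mtail J : measurable (tail_graphs J).
Proof. by apply: measurableD; apply: bigcup_measurable. Qed.

(** Weak duality against the cost increased by the indicator of the later graphs
and by all the errors; each error is integrated against the whole marginal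
[mu], as if the plan were carried by a single graph. *)
Lemma plan_cost_ge_almost_dual pi J (eps : R) : (0 < eps)%R ->
  transport_plan X Y mu nu pi -> almost_dual J eps ->
  (1 - eps)%:E <= plan_cost X Y c pi + pi (tail_graphs J `&` X `*` Y)
    + eps%:E + eps%:E.
Proof.
move=> eps0 plan [phi [psi [a [e]]]].
move=> [[pphi ppsi] [ma a0 me e0] [le1 lea lee_e] head tail].
pose t (p : T1 * T2) : \bar R := (\1_(tail_graphs J) p)%:E.
have mt : measurable_fun (X `*` Y) t by exact/measurable_EFinP/measurable_indic.
have t0 p : 0 <= t p by rewrite lee_fin.
pose E (x : T1) := \sum_(k <oo) e k x.
have mE : measurable_fun X E.
  by apply: ge0_emeasurable_sum => [k x Xx _|k _]; [exact: e0|exact: me].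
have E0 x : X x -> 0 <= E x by move=> Xx; apply: nneseries_ge0 => k _ _; exact: e0.
have eE k x : X x -> e k x <= E x.
  move=> Xx; apply: le_trans (nneseries_lim_ge k.+1 (fun n _ _ => e0 n x Xx)).
  by rewrite big_nat_recr//= leeDr// sume_ge0// => n _; exact: e0.
pose F p := c p.1 p.2 + t p + a p.1 + E p.1.
have cp0 p : (X `*` Y) p -> 0 <= c p.1 p.2 by case=> *; exact: c_ge0.
have ap0 p : (X `*` Y) p -> 0 <= a p.1 by case=> *; exact: a0.
have Ep0 p : (X `*` Y) p -> 0 <= E p.1 by case=> *; exact: E0.
have X1 f := @measurable_funX_fst _ _ _ _ _ _ Y mX f.
have mF1 : measurable_fun (X `*` Y) (fun p => c p.1 p.2 + t p) by exact: emeasurable_funD.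
have mF2 : measurable_fun (X `*` Y) (fun p => c p.1 p.2 + t p + a p.1).
  by apply: emeasurable_funD => //; exact: X1.
have F0 p : (X `*` Y) p -> 0 <= F p.
  by move=> XYp; rewrite /F !adde_ge0 ?cp0 ?ap0 ?Ep0.
have leF p : (X `*` Y) p -> phi p.1 + psi p.2 <= F p.
  move: p => [x y] [/= Xx Yy].
  have [[k _ Gk]|NG] := pselect ((\bigcup_k Gamma k) (x, y)); last first.
    rewrite /F/= c_off// !addye ?leey// gt_eqF// (lt_le_trans (ltNy0))//.
    - exact: E0.
    - exact: a0.
  have [[l /= lJ Gl]|NJ] := pselect ((\bigcup_(k < J) Gamma k) (x, y)).
    apply: (le_trans (head _ _ _ lJ Xx Yy Gl)); apply: leeD; last exact: eE.
    by rewrite -addeA leeDl// adde_ge0// a0.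
  have Jk : (J <= k)%N by rewrite leqNgt; apply/negP => kJ; apply: NJ; exists k.
  apply: (le_trans (tail _ _ _ Jk Xx Yy Gk)); apply: leeD; last exact: eE.
  apply: leeD => //; rewrite /t indicE mem_set ?leeDr ?c_ge0//.
  by split => //; exists k.
have mF : measurable_fun (X `*` Y) F by apply: emeasurable_funD => //; exact: X1.
apply: (le_trans le1); apply: (le_trans (weak_duality mX mY plan pphi ppsi mF F0 (aeW _ leF))).
rewrite [leLHS]ge0_integralD//; last 2 first.
- by move=> p XYp; rewrite !adde_ge0 ?cp0 ?ap0.
- exact: X1.
rewrite (ge0_integral_plan_fst mX mY plan mE E0).
rewrite ge0_integralD//; last 2 first.
- by move=> p XYp; rewrite adde_ge0 ?cp0.
- exact: X1.
rewrite (ge0_integral_plan_fst mX mY plan ma a0).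
rewrite ge0_integralD//.
rewrite integral_indic//.
apply: leeD; first exact: leeD.
rewrite /E integral_nneseries//.
apply: le_trans (epsilon_trick0 xpredT (ltW eps0)).
apply: lee_nneseries => // k _ _.
by apply: integral_ge0 => x; exact: e0.
Qed.

(** The later graphs shrink to the empty set, so their mass disappears in the
limit: this is where the total mass of the plan being finite is used. *)
Lemma plan_cost_ge1 pi : transport_plan X Y mu nu pi ->
  (forall eps : R, (0 < eps)%R -> \forall J \near \oo, almost_dual J eps) ->
  1 <= plan_cost X Y c pi.
Proof.
move=> plan almost.
have piXY : pi (X `*` Y) = 1 by case: plan.
have tail0 : pi (tail_graphs J `&` X `*` Y) @[J --> \oo] --> 0.
  rewrite -(measure0 pi).
  rewrite (_ : set0 = \bigcap_J (tail_graphs J `&` X `*` Y)); last first.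
    apply/esym/seteqP; split=> // p tp; have [[k _ Gk] _] := (tp 0%N I).1.
    by have [[_ NG] _] := tp k.+1 I; apply: NG; exists k => /=.
  apply: nonincreasing_cvg_mu.
  - rewrite (@le_lt_trans _ _ (pi (X `*` Y))) ?piXY ?ltry// -piXY.
    by apply: le_measure; rewrite ?inE//; exact: measurableI.
  - by move=> J; exact: measurableI.
  - by apply: bigcap_measurable => // J _; exact: measurableI.
  - move=> J K JK; apply/subsetPset => p [[Gp NG] XYp]; split => //; split => //.
    by move=> [k /= kJ Gk]; apply: NG; exists k => //=; exact: leq_trans JK.
have : 0 <= plan_cost X Y c pi by apply: integral_ge0 => p [Xp Yp]; exact: c_ge0.
move Ecost : (plan_cost X Y c pi) => [r| |]; rewrite ?leey// => _.
apply/lee_addgt0Pr => e e0; have e40 : (0 < e / 4)%R by rewrite divr_gt0.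
have tailJ : \forall J \near \oo, pi (tail_graphs J `&` X `*` Y) < (e / 4)%:E.
  by apply: (tail0 [set u | u < (e / 4)%:E]); apply: open_ereal_lt'; rewrite lte_fin.
near \oo => J.
have AJ : almost_dual J (e / 4) by near: J; exact: almost.
have tJ : pi (tail_graphs J `&` X `*` Y) < (e / 4)%:E by near: J.
have := plan_cost_ge_almost_dual e40 plan AJ; rewrite Ecost.
have : 0 <= pi (tail_graphs J `&` X `*` Y) by exact: measure_ge0.
case: (pi _) tJ => [t| |]//; rewrite lte_fin => t_lt _.
by rewrite -!EFinD !lee_fin; lra.
Unshelve. all: by end_near. Qed.
End graph_decomposition.

(** * Rotations of the circle and the cost function *)

Section rotation.
Context (R : realType) (alpha : R).
Let X : set (measurableTypeR R) := unit_circle R.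

Lemma measurable_unit_circle : measurable X.
Proof. exact: measurable_itv. Qed.
Let mX := measurable_unit_circle.

Lemma circle_rot_unit (k : int) (x : R) : unit_circle R (circle_rot alpha k x).
Proof.
rewrite /unit_circle /circle_rot /circle_add /= in_itv/=.
set y := x + _; have := floor_le y; have := floorD1_gt y; rewrite intrD.
by move=> ? ?; apply/andP; split; lra.
Qed.

Lemma measurable_floor : measurable_fun setT
  (fun x : measurableTypeR R => (Num.floor x)%:~R : measurableTypeR R).
Proof.
apply: nondecreasing_measurable => // x y xy.
by rewrite ler_int; exact: le_floor.
Qed.

Lemma measurable_circle_rot (k : int) :
  measurable_fun setT (circle_rot alpha k : measurableTypeR R -> measurableTypeR R).
Proof.
rewrite /circle_rot /circle_add; apply: measurable_funB.
  exact: measurable_funD.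
apply: (measurableT_comp measurable_floor).
exact: measurable_funD.
Qed.

(** Two representations [x + k alpha] of the same point would make a nonzero
multiple of [alpha] an integer. *)
Lemma circle_rot_inj (x : R) : irrational alpha ->
  injective (fun k => circle_rot alpha k x).
Proof.
move=> irr k l; rewrite /circle_rot /circle_add.
set m := Num.floor _; set n := Num.floor _ => E.
have {}E : (k - l)%:~R * alpha = (m - n)%:~R by rewrite !rmorphB/=; lra.
apply/eqP; rewrite -subr_eq0; apply: contra_notT irr => kl0.
have kl0R : (k - l)%:~R != 0 :> R by rewrite intr_eq0.
exists ((m - n)%:~R / (k - l)%:~R) => //.
by rewrite fmorph_div/= !ratr_int -E mulrAC divff// mul1r.
Qed.

Lemma measurable_rho (k : int) :
  measurable_fun setT (fun x : measurableTypeR R => (rho alpha k x)%:~R : R).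
Proof.
have mcount (f : nat -> measurableTypeR R -> measurableTypeR R)
    (J : interval R) (s : seq nat) :
    (forall j, measurable_fun setT (f j)) ->
    measurable_fun setT (fun x : measurableTypeR R =>
      (count (fun j => f j x \in J) s)%:Z%:~R : R).
  move=> mf; rewrite (_ : (fun x => _) =
      (fun x => \sum_(j <- s) (\1_[set` J] (f j x) : R))); last first.
    apply/funext => x; rewrite -pmulrn -sum1_count natr_sum big_mkcond/=.
    by apply: eq_bigr => j _; rewrite indicE/= mem_setE; case: (_ \in _).
  apply: measurable_sum => j; exact: measurableT_comp.
case: k => n; rewrite /rho.
  under eq_fun do rewrite rmorphB rmorphD/=.
  have m J s := mcount (fun j : nat => circle_rot alpha j%:Z) J s
    (fun j => measurable_circle_rot j%:Z).
  apply: measurable_funB; last exact: m.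
  by apply: measurable_funD; [exact: measurable_cst|exact: m].
under eq_fun do rewrite rmorphD rmorphB.
have m J s := mcount (fun j : nat => circle_rot alpha (- j%:Z)) J s
  (fun j => measurable_circle_rot (- j%:Z)).
apply: measurable_funD; last exact: m.
by apply: measurable_funB; [exact: measurable_cst|exact: m].
Qed.

Lemma measurable_circle_graph (T : measurableTypeR R -> measurableTypeR R) :
  measurable_fun X T ->
  measurable (circle_graph T : set (measurableTypeR R * measurableTypeR R)).
Proof.
move=> mT; have mXT : measurable (X `*` [set: measurableTypeR R]) by exact: measurableX.
have mfst : measurable_fun (X `*` [set: measurableTypeR R])
    (fun p : measurableTypeR R * measurableTypeR R => T p.1 : R).
  apply: (@measurable_comp _ _ _ _ _ _ X T _ fst); [exact: mX| |exact: mT|].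
    by move=> _ [p [Xp _] <-].
  exact: (measurable_funTS measurable_fst).
have msnd : measurable_fun (X `*` [set: measurableTypeR R])
    (fun p : measurableTypeR R * measurableTypeR R => p.2 : R).
  exact: (measurable_funTS measurable_snd).
have meq := measurable_fun_eqr msnd mfst mXT (Y := [set true]) I.
rewrite (_ : circle_graph T = X `*` setT `&` (fun p => p.2 == T p.1) @^-1` [set true])//.
apply/seteqP; split=> p /=; last by move=> [[Xp _] /eqP].
by move=> [Xp pE]; split; [split|apply/eqP].
Qed.

Lemma hfun_circle_rot (k : int) (x : R) : irrational alpha ->
  hfun alpha x (circle_rot alpha k x) = ((rho alpha k x)%:~R)%:E.
Proof.
move=> irr; rewrite /hfun asboolT; last by exists k.
by case: xgetP => [l _ /= /(circle_rot_inj irr) ->//|/(_ k) /(_ erefl)].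
Qed.

(** [h] is finite on countably many measurable graphs, one for each [k], on which
it is a function of [x]; off their union it is constant. *)
Lemma measurable_hfun : irrational alpha ->
  measurable_fun (X `*` X)
    (fun p : measurableTypeR R * measurableTypeR R => hfun alpha p.1 p.2).
Proof.
move=> irr; have mXX : measurable (X `*` X) by exact: measurableX.
pose D n : set (measurableTypeR R * measurableTypeR R) :=
  circle_graph (circle_rot alpha (odflt 0 (unpickle n))).
have mD n : measurable (D n).
  by apply: measurable_circle_graph; apply: measurable_funTS; exact: measurable_circle_rot.
pose U := \bigcup_n D n.
have mU : measurable U by exact: bigcup_measurable.
have mDX n : measurable_fun (D n)
    (fun p : measurableTypeR R * measurableTypeR R => hfun alpha p.1 p.2).
  pose k : int := odflt 0 (unpickle n); apply: (@eq_measurable_fun _ _ _ _ _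
    (fun p => ((rho alpha k p.1)%:~R)%:E)).
    by move=> p /set_mem [_ ->]; rewrite hfun_circle_rot.
  apply/measurable_EFinP; apply: measurable_funTS.
  exact: (measurableT_comp (measurable_rho k)).
apply: (@measurable_funS _ _ _ _ (U `|` ((X `*` X) `\` U))).
- by apply: measurableU => //; exact: measurableD.
- by move=> p XXp; have [Up|NUp] := pselect (U p); [left|right].
apply/measurable_funU => //; first exact: measurableD.
split; first exact/measurable_fun_bigcup.
apply: (@eq_measurable_fun _ _ _ _ _ (cst +oo%E)) => [p /set_mem [[Xp _] NUp]|//].
rewrite /hfun asboolF// => -[k kE]; apply: NUp; exists (pickle k) => //.
by rewrite /D pickleK.
Qed.

End rotation.

Section cost.
Context (R : realType) (alpha : R) (tau : nat -> R -> int) (i : nat -> nat).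
Let X : set (measurableTypeR R) := unit_circle R.
Hypothesis tau0 : forall x, unit_circle R x -> tau 0%N x = 0.
Hypothesis tau1 : forall x, unit_circle R x -> tau 1%N x = 1.

(** Since [tau 0 = 0] and [tau 1 = 1], the graphs of [T^0] and [T^1] are those of
[tau 0] and [tau 1], and all the graphs of the cost form one sequence. *)
Definition graph_index (k : nat) : nat := if (k < 2)%N then k else i k.

Definition cost_graph (k : nat) : set (measurableTypeR R * measurableTypeR R) :=
  circle_graph (circle_rot_by alpha (tau (graph_index k))).

Lemma costE x y : cost alpha tau i x y =
  if `[< (\bigcup_k cost_graph k) (x, y) >] then maxe (hfun alpha x y) 0%E else +oo%E.
Proof.
rewrite /cost; congr (if _ then _ else _); apply: asbool_equiv_eq; split.
  move=> [[/= Xx yE]|[[/= Xx yE]|[j j2 [/= Xx yE]]]].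
  - by exists 0%N => //; split => //=; rewrite yE /circle_rot_by tau0.
  - by exists 1%N => //; split => //=; rewrite yE /circle_rot_by tau1.
  - by exists j => //; split => //=; rewrite yE /graph_index ltnNge j2.
move=> [k _ [/= Xx yE]]; move: yE; rewrite /graph_index; case: ltnP => [|k2 yE].
  case: k => [|[|//]] _ yE.
    by left; split => //=; rewrite yE /circle_rot_by tau0.
  by right; left; split => //=; rewrite yE /circle_rot_by tau1.
by right; right; exists k.
Qed.

Lemma cost_ge0 x y : (0 <= cost alpha tau i x y)%E.
Proof. by rewrite costE; case: ifP => // _; rewrite le_max lexx orbT. Qed.

Lemma cost_graphE k x : X x ->
  cost alpha tau i x (circle_rot_by alpha (tau (graph_index k)) x) =
  maxe (hfun alpha x (circle_rot_by alpha (tau (graph_index k)) x)) 0%E.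
Proof. by move=> Xx; rewrite costE asboolT//; exists k. Qed.

Lemma measurable_cost : irrational alpha ->
  (forall n, measurable_fun X (circle_rot_by alpha (tau n))) ->
  measurable_fun (X `*` X)
    (fun p : measurableTypeR R * measurableTypeR R => cost alpha tau i p.1 p.2).
Proof.
move=> irr mT; have mX : measurable X by exact: measurable_unit_circle.
have mXX : measurable (X `*` X) by exact: measurableX.
under eq_fun do rewrite costE -surjective_pairing.
have mU : measurable (\bigcup_k cost_graph k).
  apply: bigcup_measurable => k _; apply: measurable_circle_graph; exact: mT.
apply: measurable_fun_if => //.
- apply: (measurable_fun_bool true); rewrite (_ : _ `&` _ = X `*` X `&` \bigcup_k cost_graph k).
    exact: measurableI.
  by apply/seteqP; split=> p /= [? /asboolP].
- apply: (@measurable_funS _ _ _ _ (X `*` X)); [exact: mXX|by move=> p []|].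
  by apply: measurable_maxe; [exact: (measurable_hfun irr)|exact: measurable_cst].
Qed.

End cost.

(** * Composition with measure preserving maps close to the identity *)

Section small_sequences.
Context (R : realType).
Implicit Type u : nat -> \bar R.
Local Open Scope ereal_scope.

Lemma cvge0_near_le u (e : R) : u n @[n --> \oo] --> 0 -> (0 < e)%R ->
  \forall n \near \oo, u n <= e%:E.
Proof.
move=> u_cvg e0; apply: (u_cvg [set v | v <= e%:E]).
have /filterS : (ereal_nbhs 0%E [set v : \bar R | v < e%:E]).
  by apply: open_ereal_lt'; rewrite lte_fin.
by apply => v /ltW.
Qed.

Lemma near_le_cvge0 u : (forall n, 0 <= u n) ->
  (forall e : R, (0 < e)%R -> \forall n \near \oo, u n <= e%:E) ->
  u n @[n --> \oo] --> 0.
Proof.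
move=> u0 small; apply/fine_cvgP; split.
  apply: filterS (small 1%R ltr01) => n un1.
  by rewrite ge0_fin_numE// (le_lt_trans un1)// ltry.
apply/cvgrPdist_le => e e0; apply: filterS (small e e0) => n une.
rewrite sub0r normrN ger0_norm ?fine_ge0//= -lee_fin fineK//.
by rewrite ge0_fin_numE// (le_lt_trans une)// ltry.
Qed.

Lemma near_exprVn_le (e : R) : (0 < e)%R ->
  \forall n \near \oo, (2 ^- n <= e :> R)%R.
Proof.
move=> e0; have half_cvg : ((2^-1 : R) ^+ n)%R @[n --> \oo] --> (0 : R)%R.
  by apply: cvg_expr; rewrite ger0_norm ?invr_ge0// invf_lt1// ltr1n.
have /cvgrPdist_le/(_ e e0) := half_cvg; apply: filterS => n.
by rewrite sub0r normrN ger0_norm ?exprn_ge0 ?invr_ge0// exprVn.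
Qed.

End small_sequences.

Section composition_with_almost_identity.
Context (R : realType).
Let X : set (measurableTypeR R) := unit_circle R.
Let mu : {measure set (measurableTypeR R) -> \bar R} := @lebesgue_measure R.
Let mX : measurable X. Proof. exact: measurable_unit_circle. Qed.

Lemma lebesgue_unit_circle : mu X = 1%E.
Proof.
transitivity (lebesgue_measure (`[0, 1[%classic : set R)) => //.
by rewrite lebesgue_measure_itv/= lte_fin ltr01 oppr0 adde0.
Qed.

(** The second marginal of the graph plan of [T] is Lebesgue measure. *)
Lemma ge0_integral_measure_preserving (T : measurableTypeR R -> measurableTypeR R)
    (F : measurableTypeR R -> \bar R) :
  measure_preserving T -> set_fun X X T ->
  measurable_fun X F -> (forall x, X x -> 0 <= F x)%E ->
  (\int[mu]_(x in X) F (T x) = \int[mu]_(x in X) F x)%E.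
Proof.
move=> [mT muT] XX mF F0.
have [pi plan [_ pi_int]] := graph_plan mX lebesgue_unit_circle mT XX muT.
rewrite -(ge0_integral_plan_snd mX mX plan mF F0).
rewrite (pi_int (fun p => F p.2))//; last by move=> p [_]; exact: F0.
exact: (measurable_funX_snd mX mF).
Qed.

(** Away from [0], the point where the circle is cut, circle convergence is
convergence of reals. *)
Lemma circle_dist_cvg (x : R) (y : nat -> R) : 0 < x < 1 ->
  (forall n, unit_circle R (y n)) ->
  (forall n, (1 <= n)%N -> circle_dist x (y n) < 2 ^- n) ->
  y n @[n --> \oo] --> x.
Proof.
move=> /andP[x0 x1] y01 xy.
apply/cvgrPdist_lt => e e0; near=> n.
have : circle_dist x (y n) < 2 ^- n by apply: xy; near: n; exists 1%N.
have := y01 n; rewrite /unit_circle/= in_itv/= => /andP[y0 y1].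
(* If the short way round crosses 0, then [y n] is outside [0, 1) once 2^-n is
   below the distance of [x] to the ends. *)
rewrite /circle_dist gt_min => /orP[/lt_le_trans|]; last first.
  have : 2 ^- n <= x by near: n; exact: near_exprVn_le.
  have : 2 ^- n <= 1 - x by near: n; apply: near_exprVn_le; rewrite subr_gt0.
  by move: (2 ^- n) => t; case: (ger0P (x - y n)); lra.
by apply; near: n; exact: near_exprVn_le.
Unshelve. all: by end_near. Qed.

(** For continuous functions this is dominated convergence; the general case
follows by density, because composing with a measure preserving map does not
increase the [L^1] distance to a continuous approximation. *)
Lemma cvg_L1_circle_composition (T : nat -> R -> R) (psi : R -> R) :
  (forall n, measure_preserving (T n)) ->
  (forall n, set_fun X X (T n)) ->
  (forall n x, (1 <= n)%N -> X x -> circle_dist x (T n x) < 2 ^- n) ->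
  mu.-integrable X (EFin \o psi) ->
  (\int[mu]_(x in X) `|psi (T n x) - psi x|%:E)%E @[n --> \oo] --> 0%E.
Proof.
move=> mpT XX closeT ipsi.
have mT n : measurable_fun X (T n) by case: (mpT n).
have muXy : (mu X < +oo)%E by rewrite lebesgue_unit_circle ltry.
have [g [gc ig g_cvg]] := approximation_continuous_integrable mX muXy ipsi.
have mpsi : measurable_fun X psi by apply/measurable_EFinP; case/integrableP: ipsi.
have mgn n : measurable_fun X (g n) by apply/measurable_EFinP; case/integrableP: (ig n).
have mcomp (f : R -> R) n : measurable_fun X f -> measurable_fun X (f \o T n).
  move=> mf; apply: (@measurable_comp _ _ _ _ _ _ X f _ (T n)); [exact: mX| |exact: mf|exact: mT].
  by move=> _ [x Xx <-]; exact: XX.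
have mabs (f h : R -> R) : measurable_fun X f -> measurable_fun X h ->
    measurable_fun X (fun x => `|f x - h x|%:E).
  by move=> mf mh; apply/measurable_EFinP; apply: measurableT_comp => //; exact: measurable_funB.
have cont_case k : (\int[mu]_(x in X) `|g k (T n x) - g k x|%:E)%E @[n --> \oo] --> 0%E.
  have : bounded_set (g k @` `[0, 1]).
    apply: compact_bounded; apply: continuous_compact; last exact: segment_compact.
    by apply: continuous_subspaceT => x; exact: gc.
  move=> [M [_ gM]]; have {}gM x : X x -> `|g k x| <= `|M| + 1.
    rewrite /X /unit_circle /= in_itv/= => /andP[x0 x1].
    apply: gM; first by rewrite ltr_pwDr// ler_norm.
    by exists x => //=; rewrite in_itv/= x0 ltW.
  have [|||||_ _] := @dominated_convergence _ _ _ mu X mX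
    (fun n x => `|g k (T n x) - g k x|%:E) (cst 0%E) (cst (2 * (`|M| + 1))%:E).
  - by move=> n; exact: (mabs _ _ (mcomp _ n (mgn k)) (mgn k)).
  - exact: measurable_cst.
  (* [0] is excluded, since [T n 0] may be close to 1. *)
  - exists [set 0]; split; [exact: measurable_set1|exact: lebesgue_measure_set1|].
    move=> x /= nP; apply: contrapT => /eqP x0; apply: nP => Xx.
    have x01 : 0 < x < 1.
      move: Xx; rewrite /X /unit_circle/= in_itv/= => /andP[x_ge0 ->].
      by rewrite andbT lt_def; apply/andP.
    have Tx : T n x @[n --> \oo] --> x.
      by apply: circle_dist_cvg => // n; [exact: XX|move=> n1; exact: closeT].
    apply: cvg_EFin; first exact: nearW.
    have : g k (T n x) @[n --> \oo] --> g k x by apply: cvg_comp Tx _; exact: gc.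
    by move=> /cvgB/(_ (cvg_cst (g k x)))/cvg_norm; rewrite subrr normr0.
  - apply/integrableP; split; first exact: measurable_cst.
    by rewrite (integral_cst mu mX `|2 * (`|M| + 1)|%:E) lebesgue_unit_circle mule1 ltry.
  - apply: aeW => x n Xx /=; rewrite lee_fin normr_id.
    rewrite (le_trans (ler_normB _ _))// mulr2n mulrDl mul1r lerD ?gM//.
    exact: XX.
  by rewrite integral0.
have upper k n : (\int[mu]_(x in X) `|psi (T n x) - psi x|%:E <=
    \int[mu]_(x in X) `|psi x - g k x|%:E + \int[mu]_(x in X) `|psi x - g k x|%:E +
    \int[mu]_(x in X) `|g k (T n x) - g k x|%:E)%E.
  have mpg := mabs _ _ mpsi (mgn k).
  have pg0 x : X x -> (0 <= `|psi x - g k x|%:E)%E by rewrite lee_fin.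
  have E := ge0_integral_measure_preserving (mpT n) (XX n) mpg pg0.
  rewrite -[X in (X + _ + _)%E]E.
  have mpgT := mabs _ _ (mcomp _ n mpsi) (mcomp _ n (mgn k)).
  have mgT := mabs _ _ (mcomp _ n (mgn k)) (mgn k).
  rewrite -ge0_integralD// -ge0_integralD//; last 2 first.
  - by move=> x _; rewrite -EFinD lee_fin addr_ge0.
  - exact: emeasurable_funD.
  apply: ge0_le_integral => //.
  - exact: (mabs _ _ (mcomp _ n mpsi) mpsi).
  - by apply: emeasurable_funD => //; exact: emeasurable_funD.
  move=> x _; rewrite lee_fin /=.
  have -> : psi (T n x) - psi x = (psi (T n x) - g k (T n x)) + (g k x - psi x)
    + (g k (T n x) - g k x) by ring.
  by rewrite (le_trans (ler_normD _ _))// lerD2r (le_trans (ler_normD _ _))// (distrC (g k x)).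
apply: near_le_cvge0 => [n|e e0]; first by apply: integral_ge0 => x _; rewrite lee_fin.
have e30 : 0 < e / 3 by rewrite divr_gt0.
have [k gk] : exists k, (\int[mu]_(x in X) `|psi x - g k x|%:E <= (e / 3)%:E)%E.
  have [N _ gN] := cvge0_near_le g_cvg e30.
  by exists N; exact: gN (leqnn N).
apply: filterS (cvge0_near_le (cont_case k) e30) => n gTn; apply: (le_trans (upper k n)).
rewrite (_ : e = e / 3 + e / 3 + e / 3); last by field.
by rewrite !EFinD; apply: leeD => //; exact: leeD.
Qed.
End composition_with_almost_identity.

(** * Choice of a fast growing sequence *)

(** The choice of [m] may depend on the terms up to [i j] and yet constrain all
the later ones: when [i k] is chosen, only the finitely many [m] attached to the
prefixes of [i 2, ..., i k.-1] have to be taken into account. *)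
Lemma fast_sequence_choice (P : seq nat -> nat -> Prop) (Q : nat -> nat -> nat -> Prop) :
  (forall s, exists m, P s m) ->
  (forall m k, \forall n \near \oo, Q m k n) ->
  exists G : seq nat -> nat, forall i : nat -> nat,
    (forall j, (1 <= j)%N -> (G [seq i l | l <- index_iota 2 j.+1] <= i j.+1)%N) ->
    forall j, (1 <= j)%N ->
      exists2 m, P [seq i l | l <- index_iota 2 j.+1] m &
        forall k, (j < k)%N -> Q m k (i k).
Proof.
move=> /choice[M PM] Qlarge.
have /choice[G QG] (s : seq nat) : exists N, forall n, (N <= n)%N ->
    forall l : 'I_(size s).+1, Q (M (take l s)) (size s).+2 n.
  have [N _ QN] : \forall n \near \oo, forall l : 'I_(size s).+1,
      Q (M (take l s)) (size s).+2 n by apply: filter_forall => l; exact: Qlarge.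
  by exists N => n; exact: QN.
exists G => i fast j j1.
exists (M [seq i l | l <- index_iota 2 j.+1]) => // -[//|k] jk.
have k1 : (1 <= k)%N by rewrite (leq_trans j1).
have sizek : size [seq i l | l <- index_iota 2 k.+1] = k.-1.
  by rewrite size_map size_iota subSS subn1.
have := QG _ _ (fast k k1); rewrite sizek => /(_ (inord j.-1)).
have jk1 : (j.-1 < k.-1.+1)%N by rewrite !prednK.
rewrite (inordK jk1) (prednK k1).
suff -> : take j.-1 [seq i l | l <- index_iota 2 k.+1] = [seq i l | l <- index_iota 2 j.+1] by [].
rewrite -map_take /index_iota take_iota !subSS !subn1.
by congr (map _ (iota _ _)); apply/minn_idPl; rewrite -!subn1 leq_sub2r.
Qed.

(** * Truncation of potentials *)

Section potential_tail.
Context d (T0 : measurableType d) (R : realType).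
Variables (X : set T0) (mX : measurable X) (mu : {measure set T0 -> \bar R}).
Local Open Scope ereal_scope.

Definition excess (phi : T0 -> \bar R) (K : R) (x : T0) : \bar R :=
  maxe (phi x - K%:E) 0.

Lemma excess_ge0 phi K x : 0 <= excess phi K x.
Proof. by rewrite /excess le_max lexx orbT. Qed.

Lemma le_excess phi K x : phi x <= K%:E + excess phi K x.
Proof. by rewrite -leeBlDl// /excess le_max lexx. Qed.

Lemma measurable_excess phi K : measurable_fun X phi -> measurable_fun X (excess phi K).
Proof.
move=> mphi; apply: measurable_maxe; last exact: measurable_cst.
by apply: emeasurable_funB => //; exact: measurable_cst.
Qed.

Lemma integral_excess_cvg0 phi : potential X mu phi ->
  \int[mu]_(x in X) excess phi K%:R x @[K --> \oo] --> 0.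
Proof.
move=> [iphi phiy]; have mphi := measurable_int _ iphi.
have [|||||_ _] := @dominated_convergence _ _ _ mu X mX
  (fun K x => excess phi K%:R x) (cst 0) (abse \o phi).
- by move=> K; exact: measurable_excess.
- exact: measurable_cst.
- apply: aeW => x Xx; apply: cvg_near_cst.
  move phix : (phi x) (phiy x Xx) => [r| |] // _; near=> K;
    apply/eqP; rewrite eq_le excess_ge0 andbT /excess phix ge_max lexx andbT.
    by rewrite -EFinB lee_fin subr_le0; near: K; exact: nbhs_infty_ger.
  by rewrite addNye leNye.
- exact: integrable_abse.
- apply: aeW => x K Xx; rewrite gee0_abs ?excess_ge0//= /excess ge_max abse_ge0 andbT.
  by rewrite leeBlDr// (le_trans (lee_abs _))// leeDl// lee_fin.
by rewrite integral0.
Unshelve. all: by end_near. Qed.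

End potential_tail.

(** * Values of the transport problem of the rotation *)

Section rotation_transport.
Context (R : realType) (alpha : R) (tau : nat -> R -> int).
Hypothesis irr : irrational alpha.
Hypothesis tau0 : forall x, unit_circle R x -> tau 0%N x = 0.
Hypothesis tau1 : forall x, unit_circle R x -> tau 1%N x = 1.
Hypothesis Hi : property_i alpha tau.
Let X : set (measurableTypeR R) := unit_circle R.
Let mu : {measure set (measurableTypeR R) -> \bar R} := @lebesgue_measure R.
Let T n : R -> R := circle_rot_by alpha (tau n).
Let f n (x : R) : \bar R := hfun alpha x (T n x).
Local Open Scope ereal_scope.

Let mX : measurable X. Proof. exact: measurable_unit_circle. Qed.
Let muX : mu X = 1. Proof. exact: lebesgue_unit_circle. Qed.
Let mpT n : measure_preserving (T n). Proof. by case: (Hi n). Qed.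
Let mT n : measurable_fun X (T n). Proof. by case: (mpT n). Qed.
Let XX n : set_fun X X (T n).
Proof. by move=> x _; exact: circle_rot_unit. Qed.
Let T0 x : X x -> T 0 x = x.
Proof.
move=> Xx; rewrite /T /circle_rot_by tau0// /circle_rot /circle_add mul0r addr0.
move: Xx; rewrite /X /unit_circle/= in_itv/= => x01.
by have /floor_def -> : (0%:~R <= x < (0 + 1)%:~R)%R; rewrite ?subr0.
Qed.
Let f0 x : X x -> f 0 x = 1.
Proof.
by move=> Xx; rewrite /f /T /circle_rot_by tau0// hfun_circle_rot// /rho/=.
Qed.

Let fE n x : exists r : R, f n x = r%:E.
Proof. by rewrite /f /T /circle_rot_by hfun_circle_rot//; eexists. Qed.

Let mf n : measurable_fun X (f n).
Proof. exact: (measurable_fun_graph mX mX (mT n) (XX n) (measurable_hfun irr)). Qed.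

Section upper_bounds.
Variable i : nat -> nat.
Hypothesis i_ge2 : forall j, (2 <= j)%N -> (2 <= i j)%N.
Hypothesis i_incr : forall j, (2 <= j)%N -> (i j < i j.+1)%N.
Hypothesis Hii : property_ii alpha tau.
Let c := cost alpha tau i.

Let i_ge j : (2 <= j)%N -> (j <= i j)%N.
Proof.
elim: j => [//|[_ _|[_ _|j IH _]]//]; first exact: i_ge2.
by rewrite (leq_ltn_trans (IH _))//; exact: i_incr.
Qed.

Let near_i (P : nat -> Prop) : (\forall n \near \oo, P n) ->
  exists2 j, (2 <= j)%N & P (i j).
Proof.
move=> [N _ PN]; exists (maxn N 2); first exact: leq_maxr.
by apply: PN => /=; rewrite (leq_trans (leq_maxl N 2))//; apply: i_ge; exact: leq_maxr.
Qed.

Let graph_index_i j : (2 <= j)%N -> graph_index i j = i j.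
Proof. by move=> j2; rewrite /graph_index ltnNge j2. Qed.

Let cT j x : (2 <= j)%N -> X x -> c x (T (i j) x) = maxe (f (i j) x) 0.
Proof. by move=> j2 Xx; rewrite /c -graph_index_i// cost_graphE. Qed.

Let mc : measurable_fun (X `*` X)
  (fun p : measurableTypeR R * measurableTypeR R => c p.1 p.2).
Proof. exact: measurable_cost. Qed.

(** The relaxed plans move the zero set of [g_n] along [T_n]. *)
Lemma relaxed_primal_value_eq0 : relaxed_primal_value X X mu mu c = 0.
Proof.
have [eta [g [eta_cvg gP]]] := Hii.
apply/cvg_lim => //; apply: cvg_near_cst; near=> eps.
have eps0 : (0 < eps)%R by near: eps; exact: nbhs_right_gt.
apply/eqP; rewrite eq_le; apply/andP; split; last first.
  by apply: le_ereal_inf_tmp => _ [pi _ <-]; apply: integral_ge0 => p _; exact: cost_ge0.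
apply/lee_addgt0Pr => e e0; rewrite add0e.
have [j j2 [etaj powj]] : exists2 j, (2 <= j)%N & (eta (i j) <= eps /\ 2 ^- (i j) <= e)%R.
  apply: (near_i (P := fun n => (eta n <= eps /\ 2 ^- n <= e)%R)).
  apply: filterI; last exact: near_exprVn_le.
  have /cvgrPdist_le/(_ eps eps0) := eta_cvg; apply: filterS => n.
  by rewrite sub0r normrN => /(le_trans (ler_norm _)).
have [_ mg g0 _ fg] := gP (i j) (ltnW (i_ge2 j2)).
set n := i j in etaj powj mg g0 fg.
pose A : set (measurableTypeR R) := X `&` [set x | g n x = 0%R].
have mA : measurable A by exact: (mg mX _ (measurable_set1 0%R)).
have AX : A `<=` X by move=> x [].
have [|pi piP pi_int] := relaxed_graph_plan mX (mT n) (XX n) (mpT n).2 mA AX (eps := eps).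
  by rewrite /A [X in _ <= X]g0 lee_fin lerB.
apply: (@le_trans _ _ (plan_cost X X c pi)); first by apply: ereal_inf_lbound; exists pi.
rewrite /plan_cost (pi_int (fun p => c p.1 p.2))//; last by move=> p _; exact: cost_ge0.
have mfg : measurable_fun X (fun x => `|f n x - (g n x)%:E|).
  apply: measurableT_comp => //; apply: emeasurable_funB; first exact: mf.
  exact/measurable_EFinP.
apply: (@le_trans _ _ (\int[mu]_(x in X) `|f n x - (g n x)%:E|)); last first.
  by apply: (le_trans (ltW fg)); rewrite lee_fin.
apply: (@le_trans _ _ (\int[mu]_(x in A) `|f n x - (g n x)%:E|)); last first.
  exact: ge0_subset_integral.
apply: ge0_le_integral => //.
- by move=> x _; exact: cost_ge0.
- apply: (measurable_funS mX AX).
  exact: (measurable_fun_graph mX mX (mT n) (XX n) mc).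
- exact: (measurable_funS mX AX).
move=> x [Xx gx0]; rewrite cT// gx0 sube0.
by rewrite ge_max abse_ge0 andbT lee_abs.
Unshelve. all: by end_near. Qed.

(** The potentials are tested on the graph plan of [T_n], which is finite since
[f_n] has integral [1]. On the zero set of [g_n] the bound [c <= |f_n - g_n|] is
used; on its complement [B], of mass [eta_n], the potentials are bounded by [K]
plus their excess over [K]. First [K] and then [n] is taken large. *)
Lemma relaxed_dual_value_le0 : relaxed_dual_value X X mu mu c <= 0.
Proof.
have [eta [g [eta_cvg gP]]] := Hii.
apply: ge_ereal_sup => _ [[phi psi] [/= pphi ppsi feas] <-].
have [mphi mpsi] := (measurable_int _ pphi.1, measurable_int _ ppsi.1).
apply/lee_addgt0Pr => e e0; rewrite add0e.
have e40 : (0 < e / 4)%R by rewrite divr_gt0.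
have [K [tphi tpsi]] : exists K : nat,
    \int[mu]_(x in X) excess phi K%:R x <= (e / 4)%:E /\
    \int[mu]_(x in X) excess psi K%:R x <= (e / 4)%:E.
  have [N _ NP] : \forall K \near \oo,
      \int[mu]_(x in X) excess phi K%:R x <= (e / 4)%:E /\
      \int[mu]_(x in X) excess psi K%:R x <= (e / 4)%:E.
    by apply: filterI; apply: cvge0_near_le e40; exact: integral_excess_cvg0.
  by exists N; apply: NP => /=.
have [j j2 [etaj powj]] : exists2 j, (2 <= j)%N &
    (K%:R * 2 * eta (i j) <= e / 4 /\ 2 ^- (i j) <= e / 4)%R.
  apply: (near_i (P := fun n => (K%:R * 2 * eta n <= e / 4 /\ 2 ^- n <= e / 4)%R)).
  apply: filterI; last exact: near_exprVn_le.
  have : (K%:R * 2 * eta n)%R @[n --> \oo] --> (K%:R * 2 * 0 : R)%R.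
    by apply: cvgM => //; exact: cvg_cst.
  rewrite mulr0 => /cvgrPdist_le/(_ _ e40); apply: filterS => n.
  by rewrite sub0r normrN => /(le_trans (ler_norm _)).
have [eta0 mg g0 _ fg] := gP (i j) (ltnW (i_ge2 j2)).
set n := i j in etaj powj eta0 mg g0 fg.
have [pi plan [piE pi_int]] := graph_plan mX muX (mT n) (XX n) (mpT n).2.
pose A : set (measurableTypeR R) := X `&` [set x | g n x = 0%R].
have mA : measurable A by exact: (mg mX _ (measurable_set1 0%R)).
pose B := X `\` A.
have mB : measurable B by exact: measurableD.
have muB : mu B = (eta n)%:E.
  have : mu X = mu (X `\` A) + mu (X `&` A) by exact: measureDI.
  rewrite (setIidr (_ : A `<=` X)); last by move=> x [].
  have -> : mu A = (1 - eta n)%:E by exact: g0.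
  rewrite muX -/B.
  case: (mu B) => [b| |]//; rewrite -EFinD => -[bE]; congr EFin.
  by apply: (addIr (1 - eta n)%R); rewrite -bE addrC subrK.
(* The integral of [f n] could not be 1 if that of its positive part were
   infinite. *)
have fin_pi : finite_plan X X mu mu c pi.
  split => //; rewrite /plan_cost (pi_int (fun p => c p.1 p.2))//; last first.
    by move=> p _; exact: cost_ge0.
  have [_ _ _ f_int] := Hi n; rewrite integralE in f_int.
  have -> : \int[mu]_(x in X) c x (T n x) = \int[mu]_(x in X) (f n)^\+ x.
    by apply: eq_integral => x /set_mem Xx; rewrite cT// funeposE.
  rewrite ltey; apply/eqP => fpy; move: f_int; rewrite [X in X - _ = _]fpy.
  by case: (\int[_]_(_ in _) _).
pose H (x : measurableTypeR R) : \bar R :=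
  `|f n x - (g n x)%:E| + (K%:R * 2)%:E * (\1_B x)%:E + excess phi K%:R x.
pose F (p : measurableTypeR R * measurableTypeR R) : \bar R :=
  H p.1 + excess psi K%:R p.2.
have mfg : measurable_fun X (fun x => `|f n x - (g n x)%:E|).
  apply: measurableT_comp => //; apply: emeasurable_funB; first exact: mf.
  exact/measurable_EFinP.
have mKB : measurable_fun X (fun x => (K%:R * 2)%:E * (\1_B x : R)%:E).
  apply: emeasurable_funM; first exact: measurable_cst.
  by apply/measurable_EFinP; exact: measurable_indic.
have KB0 x : 0 <= (K%:R * 2)%:E * (\1_B x : R)%:E by rewrite mule_ge0// lee_fin.
have mephi := measurable_excess K%:R mphi.
have mepsi := measurable_excess K%:R mpsi.
have X1 h := @measurable_funX_fst _ _ _ _ _ _ X mX h.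
have X2 h := @measurable_funX_snd _ _ _ _ _ X _ mX h.
have H0 x : 0 <= H x by rewrite /H !adde_ge0// excess_ge0.
have F0 p : 0 <= F p by rewrite /F adde_ge0// excess_ge0.
have mH : measurable_fun X H.
  by apply: emeasurable_funD => //; exact: emeasurable_funD.
have mF : measurable_fun (X `*` X) F.
  by apply: emeasurable_funD; [exact: X1|exact: X2].
have leF : {ae pi, forall p, (X `*` X) p -> phi p.1 + psi p.2 <= F p}.
  have on_graph : {ae pi, forall p, circle_graph (T n) p}.
    exists (~` circle_graph (T n)); split => //.
      exact: (measurableC (measurable_circle_graph (mT n))).
    rewrite piE; last exact: (measurableC (measurable_circle_graph (mT n))).
    rewrite [X in mu X](_ : _ = set0) ?measure0//; apply/seteqP.
    by split=> x //= [Xx]; apply.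
  have ae_pi : Filter (almost_everywhere pi) := ae_filter_ringOfSetsType pi.
  apply: (@filterS2 _ _ ae_pi _ _ _ _ on_graph (feas _ fin_pi)).
  move=> -[x y] [/= Xx ->] le_c [_ XTx].
  have [gx0|gx] := pselect (g n x = 0%R).
    apply: (le_trans (le_c Xx XTx)); rewrite cT// /F/= /H gx0 sube0.
    rewrite -!addeA (@le_trans _ _ `|f n x|)//.
      by rewrite ge_max abse_ge0 andbT lee_abs.
    by rewrite leeDl// !adde_ge0// excess_ge0.
  have Bx : B x by split => // -[_].
  rewrite /F/= /H indicE mem_set// mule1.
  apply: (@le_trans _ _ ((K%:R%:E + excess phi K%:R x) + (K%:R%:E + excess psi K%:R (T n x)))).
    by apply: leeD; exact: le_excess.
  rewrite mulr2n mulrDr mulr1 EFinD.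
  rewrite addeACA -!addeA leeDr//.
apply: (le_trans (weak_duality mX mX plan pphi ppsi mF (fun p _ => F0 p) leF)).
rewrite /F ge0_integralD//; [|exact: measurableX|exact: X1|
  by move=> p _; exact: excess_ge0|exact: X2].
rewrite (ge0_integral_plan_fst mX mX plan mH)//.
rewrite (ge0_integral_plan_snd mX mX plan mepsi); last by move=> x _; exact: excess_ge0.
rewrite /H ge0_integralD//; [|by move=> x _; rewrite adde_ge0|
  exact: emeasurable_funD|by move=> x _; exact: excess_ge0].
rewrite ge0_integralD// ge0_integralZl//; last exact/measurable_EFinP/measurable_indic.
rewrite integral_indic// setIidl; last by move=> x [].
rewrite muB -EFinM (_ : e = e / 4 + e / 4 + e / 4 + e / 4)%R; last by field.
rewrite !EFinD; apply: leeD => //; apply: leeD => //; apply: leeD; last by rewrite lee_fin.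
by apply: (le_trans (ltW fg)); rewrite lee_fin.
Qed.

End upper_bounds.

(** The certificates required by [plan_cost_ge1] come from (iii): the error on a
graph among the first [J] is [|h - phi_m - psi_m|], and on a later graph it is
[|psi_m (T_n x) - psi_m x|], the other error being [|phi_m x + psi_m x - 1|]. *)
Lemma plan_cost_ge1_of_fast_growth :
  property_iii alpha tau -> property_iv alpha tau ->
  exists G : seq nat -> nat, forall i : nat -> nat,
    (forall j, (1 <= j)%N ->
       (G [seq i l | l <- index_iota 2 j.+1] <= i j.+1)%N) ->
    forall pi, transport_plan X X mu mu pi ->
      1 <= plan_cost X X (cost alpha tau i) pi.
Proof.
move=> [phi [psi [bphi bpsi D_cvg L_cvg]]] Hiv.
pose D m n := L1_norm (fun x => f n x - (phi m x + psi m (T n x))%:E).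
pose L m := dual_payoff X X mu mu (EFin \o phi m, EFin \o psi m).
pose b m n := \int[mu]_(x in X) `|psi m (T n x) - psi m x|%:E.
pose tol (s : seq nat) : R := (2 ^- size s)%R.
have tol0 s : (0 < tol s)%R by rewrite invr_gt0 exprn_gt0.
(* [s] lists the indices [i 2, ..., i j], to which [0] and [1] are prefixed. *)
pose P s m := [/\ (1 <= m)%N, (1 - tol s)%:E <= L m, D m 0%N <= (tol s)%:E &
  forall k : 'I_(size s).+2,
    D m (nth 0%N [:: 0, 1 & s]%N k) <= (tol s / (2 ^ k.+1)%:R)%:E].
pose Q m k n := (1 <= m)%N -> b m n <= (2 ^- k / (2 ^ k.+1)%:R)%:E.
have pow0 k : (0 < (2 ^ k.+1)%:R :> R)%R by rewrite ltr0n expn_gt0.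
have iphi m : (1 <= m)%N -> mu.-integrable X (EFin \o phi m).
  move=> /bphi[mphi bdphi]; apply: measurable_bounded_integrable => //.
  by rewrite -/mu muX ltry.
have ipsi m : (1 <= m)%N -> mu.-integrable X (EFin \o psi m).
  move=> /bpsi[mpsi bdpsi]; apply: measurable_bounded_integrable => //.
  by rewrite -/mu muX ltry.
have exP s : exists m, P s m.
  have [N _ NP] : \forall m \near \oo, P s m.
    have m1 : \forall m \near \oo, (1 <= m)%N by exists 1%N.
    have Lm : \forall m \near \oo, (1 - tol s)%:E < L m.
      apply: (L_cvg [set v | (1 - tol s)%:E < v]); apply: open_ereal_gt'.
      by rewrite lte_fin gtrBl.
    have Dm : \forall m \near \oo, forall k : 'I_(size s).+2,
        D m (nth 0%N [:: 0, 1 & s]%N k) <= (tol s / (2 ^ k.+1)%:R)%:E.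
      apply: filter_forall => k; apply: (cvge0_near_le (D_cvg _)).
      by rewrite divr_gt0.
    near=> m; split; [by near: m|apply: ltW; near: m; exact: Lm| |by near: m].
    by near: m; exact: (cvge0_near_le (D_cvg 0%N)).
  by exists N; exact: NP (leqnn N).
have exQ m k : \forall n \near \oo, Q m k n.
  have [m0|m0] := leqP m 0; first by apply: nearW => n; rewrite /Q lt0n -leqn0 m0.
  have := cvg_L1_circle_composition mpT XX Hiv (ipsi _ m0).
  move=> /cvge0_near_le => /(_ (2 ^- k / (2 ^ k.+1)%:R)%R).
  rewrite divr_gt0// ?invr_gt0 ?exprn_gt0// => /(_ isT).
  by apply: filterS => n bn _.
have [G GP] := fast_sequence_choice exP exQ.
exists G => i fast pi plan.
apply: (@plan_cost_ge1 _ _ _ _ _ X X mX mX mu mu _ (cost_graph alpha tau i)) => //.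
- by move=> k; apply: measurable_circle_graph; exact: mT.
- exact: measurable_cost.
- by move=> x y _ _; exact: cost_ge0.
- by move=> x y _ _ NG; rewrite costE// asboolF.
move=> eps eps0.
have [N _ NP] := near_exprVn_le eps0.
exists N.+2 => // -[//|[//|t]] Nt.
have [m [m1 Lm Dm0 Dm] Qm] := GP i fast t.+1 isT.
set s := [seq i l | l <- index_iota 2 t.+2] in Lm Dm0 Dm.
have sizes : size s = t by rewrite size_map size_iota subSS subn1.
have tol_eps : (tol s <= eps)%R by rewrite /tol sizes; apply: NP; rewrite /= -ltnS -ltnS.
have s_index k : (k < t.+2)%N -> nth 0%N [:: 0, 1 & s]%N k = graph_index i k.
  case: k => [|[|k]]// kt; rewrite /= /graph_index/= (nth_map 0%N); last first.
    by rewrite size_iota !subSS subn0.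
  by rewrite nth_iota// !subSS subn0.
have mphi : measurable_fun X (phi m) by case: (bphi _ m1).
have mpsi : measurable_fun X (psi m) by case: (bpsi _ m1).
have mpsiT n : measurable_fun X (psi m \o T n).
  by apply: (@measurable_comp _ _ _ _ _ _ X (psi m) _ (T n)); [exact: mX|
    move=> _ [x Xx <-]; exact: XX|exact: mpsi|exact: mT].
pose e k x : \bar R := if (k < t.+2)%N
  then `|f (graph_index i k) x - (phi m x + psi m (T (graph_index i k) x))%:E|
  else `|psi m (T (graph_index i k) x) - psi m x|%:E.
pose a (x : R) : \bar R := `|phi m x + psi m x - 1|%:E.
rewrite /= /almost_dual; exists (EFin \o phi m), (EFin \o psi m), a, e.
split.
- by split; (split; last by move=> x _; rewrite /= ltry); [exact: iphi|exact: ipsi].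
- split=> //.
  + apply/measurable_EFinP; apply: measurableT_comp => //.
    by apply: measurable_funB; [exact: measurable_funD|exact: measurable_cst].
  + by move=> x _; rewrite lee_fin.
  + move=> k; rewrite /e; case: (k < t.+2)%N.
      apply: measurableT_comp => //; apply: emeasurable_funB; first exact: mf.
      by apply/measurable_EFinP; apply: measurable_funD; [exact: mphi|exact: mpsiT].
    apply/measurable_EFinP; apply: measurableT_comp => //.
    by apply: measurable_funB; [exact: mpsiT|exact: mpsi].
  + by move=> k x _; rewrite /e; case: ifP.
- split.
  + by apply: le_trans Lm; rewrite lee_fin lerB.
  + rewrite (_ : \int[mu]_(x in X) _ = D m 0%N).
      by apply: (le_trans Dm0); rewrite lee_fin.
    apply: eq_integral => x /set_mem Xx; rewrite f0// T0//.
    by rewrite -EFinB/= distrC.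
  + move=> k; rewrite /e; case: ltnP => [kt|tk].
      rewrite -(s_index k)//; have kt' : (k < (size s).+2)%N by rewrite sizes.
      apply: (le_trans (Dm (Ordinal kt'))); rewrite lee_fin.
      by rewrite ler_pM2r// invr_gt0.
    have -> : graph_index i k = i k by rewrite /graph_index ltnNge (leq_trans _ tk).
    apply: (le_trans (Qm k tk m1)); rewrite lee_fin ler_pM2r ?invr_gt0//.
    exact: NP (leq_trans (leq_trans (leqW (leqnSn N)) Nt) tk).
- move=> k x y kt Xx Yy [_ /= ->]; rewrite /e kt costE// asboolT; last by exists k.
  have [r fr] := fE (graph_index i k) x; rewrite -/(T _ x) -/(f _ x) fr.
  rewrite -EFin_max -EFinB /= -!EFinD lee_fin.
  set u := psi m _; have := ler_norm (phi m x + u - r)%R; rewrite distrC.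
  by case: (leP r 0%R); lra.
- move=> k x y tk Xx Yy [_ /= ->]; rewrite /e ltnNge tk /= /a -!EFinD lee_fin.
  set y' := psi m _; have := ler_norm (phi m x + psi m x - 1)%R.
  by have := ler_norm (y' - psi m x)%R; lra.
Unshelve. all: by end_near. Qed.

End rotation_transport.

Theorem proposition4p3 (R : realType) (alpha : R) (tau : nat -> R -> int)
    (alpha01 : unit_circle R alpha) (alpha_irr : irrational alpha)
    (tau0 : forall x, unit_circle R x -> tau 0%N x = 0)
    (tau1 : forall x, unit_circle R x -> tau 1%N x = 1)
    (Hi : property_i alpha tau) (Hii : property_ii alpha tau)
    (Hiii : property_iii alpha tau) (Hiv : property_iv alpha tau) :
  exists G : seq nat -> nat,
    forall i : nat -> nat,
      (forall j, (2 <= j)%N -> (2 <= i j)%N) ->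
      (forall j, (2 <= j)%N -> (i j < i j.+1)%N) ->
      (forall j, (1 <= j)%N ->
         (G [seq i l | l <- index_iota 2 j.+1] <= i j.+1)%N) ->
      let X : set (measurableTypeR R) := unit_circle R in
      let mu : {measure set (measurableTypeR R) -> \bar R} := @lebesgue_measure R in
      let c := cost alpha tau i in
      [/\ (0 < primal_value X X mu mu c)%E,
          relaxed_primal_value X X mu mu c = 0%E,
          dual_value X X mu mu c = 0%E,
          relaxed_dual_value X X mu mu c = 0%E &
          (0 < primal_value X X mu mu c - relaxed_dual_value X X mu mu c)%E].
Proof.
have [G GP] := plan_cost_ge1_of_fast_growth alpha_irr tau0 tau1 Hi Hiii Hiv.
exists G => i i2 i_incr fast X mu c.
have primal1 : (1 <= primal_value X X mu mu c)%E.
  by apply: le_ereal_inf_tmp => _ [pi plan <-]; exact: GP.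
have primal0 := lt_le_trans lte01 primal1.
have dual_rel := dual_value_le_relaxed X X mu mu c.
have rel0 := relaxed_dual_value_le0 alpha_irr tau0 tau1 Hi i2 i_incr Hii.
have dual0 : (0 <= dual_value X X mu mu c)%E.
  by apply: dual_value_ge0 => x y _ _; exact: cost_ge0.
have relE : relaxed_dual_value X X mu mu c = 0%E.
  by apply/eqP; rewrite eq_le rel0 (le_trans dual0 dual_rel).
split=> //.
- exact: (relaxed_primal_value_eq0 alpha_irr tau0 tau1 Hi i2 i_incr Hii).
- by apply/eqP; rewrite eq_le dual0 (le_trans dual_rel rel0).
- by rewrite relE sube0.
Qed.
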